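(* Let $D\colon \mathsf{Fin}^{\mathrm{op}}\to\mathsf{Fin}$ be a functor. The following are equivalent: 1. $D$ is a Dirichlet polynomial. 2. $D$ is a sum of representables. 3. $D$ sends connected colimits to limits; or equivalently, $D$ sends wide pushouts to wide pullbacks. (In item 3, both formulations of the condition are asserted to be equivalent to each other and to items 1 and 2.)
   Context: $\mathsf{Fin}$ is the category of finite sets and functions. For a finite set $k$, $k^{\mathcal{y}}$ denotes the representable presheaf $\mathsf{Fin}(-,k)\colon\mathsf{Fin}^{\mathrm{op}}\to\mathsf{Fin}$; a natural number $k$ is identified with a finite set having $k$ elements. Sums (coproducts) of functors are computed pointwise as disjoint unions. The empty sum (the constant functor at $\emptyset$) is allowed. A Dirichlet polynomial is a functor $D\colon\mathsf{Fin}^{\mathrm{op}}\to\mathsf{Fin}$ that is (up to natural isomorphism) of the form $D(\mathcal{y})=a_n\, n^{\mathcal{y}}+\cdots+a_2\,2^{\mathcal{y}}+a_1\,1^{\mathcal{y}}+a_0\,0^{\mathcal{y}}$ with coefficients $a_i\in\mathbb{N}$, where $a_i\, i^{\mathcal{y}}$ denotes the $a_i$-fold coproduct of copies of $i^{\mathcal{y}}$. A sum of representables means a functor isomorphic to $\sum_{i\in I}(d_i)^{\mathcal{y}}$ for a family of finite sets $(d_i)_{i\in I}$. Evaluating at the empty set shows that $I\cong D(0)$, so $I$ is necessarily finite because $D$ takes values in $\mathsf{Fin}$. A connected colimit is a colimit (existing in $\mathsf{Fin}$) of a diagram indexed by a connected (in particular nonempty) category. A wide pushout is a colimit of a family of morphisms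 with a common domain; a wide pullback is a limit of a family of morphisms with a common codomain. ''$D$ sends connected colimits to limits'' means that for each colimit cocone in $\mathsf{Fin}$ of a diagram $X\colon J\to\mathsf{Fin}$ with $J$ connected, the image cone under $D$ is a limit cone of $D\circ X^{\mathrm{op}}$. *)

(* Defs.v *)
From Stdlib Require Relation_Operators.
From mathcomp Require Import all_boot.

Set Implicit Arguments.
Unset Strict Implicit.
Unset Printing Implicit Defensive.

Declare Scope cat_scope.
Delimit Scope cat_scope with cat.
Local Open Scope cat_scope.

Record category := Category {
  obj :> Type;
  hom : obj -> obj -> Type;
  idm : forall a, hom a a;
  compose : forall a b c, hom b c -> hom a b -> hom a c;
  compose1m : forall a b (f : hom a b), compose (idm b) f = f;
  composem1 : forall a b (f : hom a b), compose f (idm a) = f;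
  composeA : forall a b c d (h : hom c d) (g : hom b c) (f : hom a b),
    compose h (compose g f) = compose (compose h g) f
}.

Arguments hom {C} a b : rename.
Arguments idm {C} a : rename.
Arguments compose {C a b c} g f : rename.

Notation "g ∘ f" := (compose g f)
  (at level 40, left associativity) : cat_scope.

Definition op (C : category) : category :=
  @Category C (fun a b => @hom C b a) (@idm C) (fun a b c g f => f ∘ g)
    (fun a b f => composem1 f) (fun a b f => compose1m f)
    (fun a b c d h g f => esym (composeA f g h)).

Record functor (C D : category) := Functor {
  fobj :> C -> D;
  fmap : forall a b, hom a b -> hom (fobj a) (fobj b);
  fmap_id : forall a, fmap (idm a) = idm (fobj a);
  fmap_comp : forall a b c (g : hom b c) (f : hom a b),
    fmap (g ∘ f) = fmap g ∘ fmap f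
}.

Arguments fmap {C D} F {a b} f : rename.

Definition op_functor (C D : category) (F : functor C D) :
    functor (op C) (op D) :=
  @Functor (op C) (op D) F (fun a b f => @fmap C D F b a f)
    (fmap_id F) (fun a b c g f => fmap_comp F f g).

Lemma comp_functor_id (C D E : category) (G : functor D E) (F : functor C D)
  (a : C) : fmap G (fmap F (idm a)) = idm (G (F a)).
Proof. by rewrite !fmap_id. Qed.

Lemma comp_functor_comp (C D E : category) (G : functor D E) (F : functor C D)
    (a b c : C) (g : hom b c) (f : hom a b) :
  fmap G (fmap F (g ∘ f)) = fmap G (fmap F g) ∘ fmap G (fmap F f).
Proof. by rewrite !fmap_comp. Qed.

Definition comp_functor (C D E : category) (G : functor D E) (F : functor C D) :
    functor C E :=
  @Functor C E (fun a => G (F a)) (fun a b f => fmap G (fmap F f))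
    (comp_functor_id G F) (comp_functor_comp G F).

Record nat_trans (C D : category) (F G : functor C D) := NatTrans {
  component :> forall a, hom (F a) (G a);
  naturality : forall a b (f : hom a b),
    component b ∘ fmap F f = fmap G f ∘ component a
}.

Definition nat_isomorphic (C D : category) (F G : functor C D) : Prop :=
  exists (u : nat_trans F G) (v : nat_trans G F),
    (forall a, v a ∘ u a = idm (F a)) /\ (forall a, u a ∘ v a = idm (G a)).

Definition is_colimit (J C : category) (X : functor J C) (L : C)
    (q : forall j, hom (X j) L) : Prop :=
  (forall i j (f : hom i j), q j ∘ fmap X f = q i) /\
  (forall (T : C) (t : forall j, hom (X j) T),
     (forall i j (f : hom i j), t j ∘ fmap X f = t i) ->
     exists! h : hom L T, forall j, h ∘ q j = t j).

Definition is_limit (J C : category) (X : functor J C) (L : C)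
    (p : forall j, hom L (X j)) : Prop :=
  (forall i j (f : hom i j), fmap X f ∘ p i = p j) /\
  (forall (T : C) (t : forall j, hom T (X j)),
     (forall i j (f : hom i j), fmap X f ∘ t i = t j) ->
     exists! h : hom T L, forall j, p j ∘ h = t j).

Definition connected (J : category) : Prop :=
  inhabited J /\
  forall i j : J, Relation_Operators.clos_refl_sym_trans J (fun a b => inhabited (hom a b)) i j.

(* The leg [c] out of the common domain is part of the cocone: it is
   determined by the [q i] except when the family is empty.  Dually below. *)
Definition is_wide_pushout (C : category) (I : Type) (A : C) (B : I -> C)
    (f : forall i, hom A (B i)) (P : C) (c : hom A P)
    (q : forall i, hom (B i) P) : Prop :=
  (forall i, q i ∘ f i = c) /\
  (forall (T : C) (s : hom A T) (t : forall i, hom (B i) T),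
     (forall i, t i ∘ f i = s) ->
     exists! h : hom P T, h ∘ c = s /\ forall i, h ∘ q i = t i).

Definition is_wide_pullback (C : category) (I : Type) (A : C) (B : I -> C)
    (f : forall i, hom (B i) A) (P : C) (c : hom P A)
    (p : forall i, hom P (B i)) : Prop :=
  (forall i, f i ∘ p i = c) /\
  (forall (T : C) (s : hom T A) (t : forall i, hom T (B i)),
     (forall i, f i ∘ t i = s) ->
     exists! h : hom T P, c ∘ h = s /\ forall i, p i ∘ h = t i).

Definition fin_comp (A B C : finType) (g : {ffun B -> C}) (f : {ffun A -> B}) :
  {ffun A -> C} := [ffun x => g (f x)].

Lemma fin_comp1m (A B : finType) (f : {ffun A -> B}) :
  fin_comp [ffun x => x] f = f.
Proof. by apply/ffunP => x; rewrite !ffunE. Qed.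

Lemma fin_compm1 (A B : finType) (f : {ffun A -> B}) :
  fin_comp f [ffun x => x] = f.
Proof. by apply/ffunP => x; rewrite !ffunE. Qed.

Lemma fin_compA (A B C D : finType) (h : {ffun C -> D}) (g : {ffun B -> C})
  (f : {ffun A -> B}) : fin_comp h (fin_comp g f) = fin_comp (fin_comp h g) f.
Proof. by apply/ffunP => x; rewrite !ffunE. Qed.

Definition Fin : category :=
  @Category finType (fun A B => {ffun A -> B}) (fun A => [ffun x => x])
    fin_comp fin_comp1m fin_compm1 fin_compA.

(* [fmap F f] as a map between the underlying types *)
Definition fapp (C : category) (F : functor C Fin) (a b : C) (f : hom a b) :
  (F a : finType) -> (F b : finType) :=
  fun x => (fmap F f : {ffun (F a : finType) -> (F b : finType)}) x.

Arguments fapp {C} F {a b} f x.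

Definition rep_map (d X Y : finType) (f : {ffun Y -> X}) :
  {ffun {ffun X -> d} -> {ffun Y -> d}} := [ffun g => fin_comp g f].

Lemma rep_map_id (d X : finType) :
  rep_map d [ffun x : X => x] = [ffun g => g].
Proof. by apply/ffunP => g; rewrite !ffunE fin_compm1. Qed.

Lemma rep_map_comp (d X Y Z : finType) (g : {ffun Z -> Y}) (f : {ffun Y -> X}) :
  rep_map d (fin_comp f g) = fin_comp (rep_map d g) (rep_map d f).
Proof. by apply/ffunP => h; rewrite !ffunE fin_compA. Qed.

(* The representable presheaf [d^y], i.e. [Fin(-, d)] *)
Definition representable (d : finType) : functor (op Fin) Fin :=
  @Functor (op Fin) Fin (fun X : finType => {ffun X -> d})
    (fun X Y f => @rep_map d X Y f) (rep_map_id d)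
    (fun X Y Z g f => @rep_map_comp d X Y Z g f).

Definition sum_obj (C : category) (I : finType) (F : I -> functor C Fin)
  (a : C) : finType := {i : I & (F i a : finType)}.

Definition sum_map (C : category) (I : finType) (F : I -> functor C Fin)
    (a b : C) (f : hom a b) : {ffun sum_obj F a -> sum_obj F b} :=
  [ffun u => existT (fun i => F i b : finType) (tag u)
                    (fapp (F (tag u)) f (tagged u))].

Lemma sum_map_id (C : category) (I : finType) (F : I -> functor C Fin) (a : C) :
  sum_map F (idm a) = [ffun u => u].
Proof. by apply/ffunP => -[i x]; rewrite !ffunE /fapp fmap_id ffunE. Qed.

Lemma sum_map_comp (C : category) (I : finType) (F : I -> functor C Fin)
    (a b c : C) (g : hom b c) (f : hom a b) :
  sum_map F (g ∘ f) = fin_comp (sum_map F g) (sum_map F f).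
Proof. by apply/ffunP => -[i x]; rewrite !ffunE /fapp fmap_comp ffunE. Qed.

Definition fin_sum (C : category) (I : finType) (F : I -> functor C Fin) :
    functor C Fin :=
  @Functor C Fin (sum_obj F) (@sum_map C I F) (sum_map_id F)
    (@sum_map_comp C I F).

(* [a_n n^y + ... + a_1 1^y + a_0 0^y] *)
Definition dirichlet_poly (n : nat) (a : 'I_n.+1 -> nat) :
    functor (op Fin) Fin :=
  fin_sum (fun k : 'I_n.+1 =>
    fin_sum (fun _ : 'I_(a k) => representable 'I_k)).

Definition is_dirichlet_polynomial (D : functor (op Fin) Fin) : Prop :=
  exists (n : nat) (a : 'I_n.+1 -> nat), nat_isomorphic D (dirichlet_poly a).

(* [D] is naturally isomorphic to the pointwise disjoint union of the [F i].
   The index type is not assumed finite, so that this disjoint union is only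
   a functor to sets; hence the natural bijection is spelled out. *)
Definition is_sum (C : category) (I : Type) (F : I -> functor C Fin)
    (D : functor C Fin) : Prop :=
  exists phi : forall a : C, {i : I & (F i a : finType)} -> (D a : finType),
    (forall a, bijective (phi a)) /\
    (forall (a b : C) (f : hom a b) (i : I) (x : (F i a : finType)),
       fapp D f (phi a (existT _ i x)) =
       phi b (existT _ i (fapp (F i) f x))).

Definition is_sum_of_representables (D : functor (op Fin) Fin) : Prop :=
  exists (I : Type) (d : I -> finType), is_sum (fun i => representable (d i)) D.

Definition sends_connected_colimits_to_limits (D : functor (op Fin) Fin) :
    Prop :=
  forall (J : category) (X : functor J Fin) (L : Fin)
      (q : forall j, hom (X j) L),
    connected J -> is_colimit q ->
    @is_limit (op J) Fin (comp_functor D (op_functor X)) (D L)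
      (fun j => @fmap _ _ D L (X j) (q j)).

Definition sends_wide_pushouts_to_wide_pullbacks (D : functor (op Fin) Fin) :
    Prop :=
  forall (I : Type) (A : Fin) (B : I -> Fin) (f : forall i, hom A (B i))
      (P : Fin) (c : hom A P) (q : forall i, hom (B i) P),
    is_wide_pushout f c q ->
    @is_wide_pullback Fin I (D A) (fun i => D (B i))
      (fun i => @fmap _ _ D (B i) A (f i)) (D P) (@fmap _ _ D P A c)
      (fun i => @fmap _ _ D P (B i) (q i)).

(* Main.v *)
Require Import Defs.
From Stdlib Require Import Relation_Operators Eqdep_dec.
From mathcomp Require Import all_boot.

(* A finite set X is the wide pushout of its points over the empty set, so a
   functor D sending wide pushouts to wide pullbacks has D(X) equal to the
   X-fold fibre power of D(1) over D(0); that is, D is the sum over s in D(0) of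
   the functors represented by the fibres of D(1) -> D(0) over s.  Conversely,
   in a sum of representables a compatible family of elements indexed by a
   connected category stays in a single summand, and a representable sends
   every colimit to a limit. *)

Set Implicit Arguments.
Unset Strict Implicit.
Unset Printing Implicit Defensive.

Local Open Scope cat_scope.

(** * Functors into finite sets: isomorphisms and limits, checked on elements *)

Lemma inj_surj_bij (A : choiceType) (B : eqType) (f : A -> B) :
  injective f -> (forall y, exists x, f x == y) -> bijective f.
Proof.
move=> f_inj f_surj; exists (fun y => xchoose (f_surj y)) => [x|y].
  by apply: f_inj; apply/eqP; apply: (xchooseP (f_surj (f x))).
by apply/eqP; apply: (xchooseP (f_surj y)).
Qed.

Lemma fin_composeE (A B C : Fin) (g : hom B C) (f : hom A B)
    (x : (A : finType)) :
  ((g ∘ f : {ffun _ -> _}) x) = (g : {ffun _ -> _}) ((f : {ffun _ -> _}) x).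
Proof. exact: ffunE. Qed.

Lemma fapp_comp (C : category) (F : functor C Fin) (a b c : C) (g : hom b c)
    (f : hom a b) (x : (F a : finType)) :
  fapp F (g ∘ f) x = fapp F g (fapp F f x).
Proof. by rewrite /fapp fmap_comp fin_composeE. Qed.

Lemma fapp_representable (d X Y : finType) (f : {ffun Y -> X})
    (g : {ffun X -> d}) :
  @fapp (op Fin) (representable d) X Y f g = fin_comp g f.
Proof. exact: ffunE. Qed.

(** Pointwise inverses of a natural transformation are automatically natural; finiteness supplies
    them by [xchoose] without a choice axiom. *)
Lemma nat_isomorphic_bij (C : category) (F G : functor C Fin)
    (u : nat_trans F G) :
  (forall a, bijective (u a : {ffun _ -> _})) -> nat_isomorphic F G.
Proof.
move=> u_bij.
have u_surj a (y : (G a : finType)) :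
    exists x, (u a : {ffun (F a : finType) -> _}) x == y.
  by have [g _ gK] := u_bij a; exists (g y); rewrite gK.
pose v a : hom (G a) (F a) :=
  [ffun y => xchoose (u_surj a y)] : {ffun (G a : finType) -> (F a : finType)}.
have vK a : u a ∘ v a = idm (G a).
  apply/ffunP => y; rewrite fin_composeE [RHS]ffunE [in LHS]ffunE.
  by apply/eqP; apply: (xchooseP (u_surj a y)).
have uK a : v a ∘ u a = idm (F a).
  apply/ffunP => x; apply: (bij_inj (u_bij a)).
  rewrite -fin_composeE composeA vK compose1m.
  by rewrite [in RHS]ffunE.
have v_nat a b (f : hom a b) : v b ∘ fmap G f = fmap F f ∘ v a.
  (* Inserting [u a ∘ v a] lets naturality of [u] slide [fmap G f] across, after which [v b ∘ u b]
     cancels. *)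
  rewrite -[fmap G f]composem1 -(vK a) [X in _ ∘ X]composeA -naturality.
  by rewrite !composeA uK compose1m.
by exists u, (NatTrans v_nat).
Qed.

(** Cones need testing only on one-point apexes: a cone from [T] is a family of such cones indexed
    by the elements of [T], and finite choice over [T] assembles the mediating map. *)
Lemma is_limit_elementwise (J : category) (X : functor J Fin) (L : Fin)
    (p : forall j, hom L (X j)) :
  (forall i j (f : hom i j), fmap X f ∘ p i = p j) ->
  (forall x : forall j, (X j : finType),
     (forall i j (f : hom i j), fapp X f (x i) = x j) ->
     exists! y : (L : finType), forall j, (p j : {ffun _ -> _}) y = x j) ->
  is_limit p.
Proof.
move=> p_cone p_lim; split=> // T t t_cone.
have /fin_all_exists[h hP] (z : (T : finType)) : exists y : (L : finType),
    unique (fun y => forall j, (p j : {ffun _ -> _}) y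
                               = (t j : {ffun (T : finType) -> _}) z) y.
  apply: p_lim => i j f.
  by rewrite -(t_cone i j f) fin_composeE.
exists (finfun h : {ffun (T : finType) -> (L : finType)}).
split=> [j|h' h'P].
  by apply/ffunP => z; rewrite fin_composeE ffunE; case: (hP z).
apply/ffunP => z; rewrite ffunE; case: (hP z) => _; apply=> j.
by rewrite -(h'P j) fin_composeE.
Qed.

(** * Dirichlet polynomials as sums of representables *)

Lemma dirichlet_polynomial_sum (D : functor (op Fin) Fin) :
  is_dirichlet_polynomial D -> is_sum_of_representables D.
Proof.
case=> n [a [u [v [uK vK]]]].
(* The double sum is reindexed by pairs of a degree [k] and a copy number below [a k]; [flatten] and
   [nest] reassociate the dependent pairs. *)
pose d (p : {k : 'I_n.+1 & 'I_(a k)}) : finType := 'I_(tag p).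
exists {k : 'I_n.+1 & 'I_(a k)}, d.
pose sumX (X : finType) : finType := @sum_obj (op Fin) _ (fun k : 'I_n.+1 =>
  fin_sum (fun _ : 'I_(a k) => representable 'I_k)) X.
pose flatten (X : finType) (s : sumX X) : {p & {ffun X -> d p}} :=
  existT (fun p => {ffun X -> d p})
    (existT (fun k => 'I_(a k)) (tag s) (tag (tagged s))) (tagged (tagged s)).
pose nest (X : finType) (p : {p & {ffun X -> d p}}) : sumX X :=
  existT _ (tag (tag p)) (existT _ (tagged (tag p)) (tagged p)).
have flattenK X : cancel (@flatten X) (@nest X) by case=> k [l g].
have nestK X : cancel (@nest X) (@flatten X) by case=> -[k l] g.
pose uf (X : finType) : {ffun (D X : finType) -> sumX X} := u X.
pose vf (X : finType) : {ffun sumX X -> (D X : finType)} := v X.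
have ufK X : cancel (uf X) (vf X).
  by move=> z; rewrite -[LHS]fin_composeE uK ffunE.
have vfK X : cancel (vf X) (uf X).
  by move=> z; rewrite -[LHS]fin_composeE vK ffunE.
exists (fun (X : finType) p => vf X (nest X p)).
split=> [X|X Y f i x].
  exists (fun z => flatten X (uf X z)) => [p|z]; first by rewrite vfK nestK.
  by rewrite flattenK ufK.
rewrite /fapp -[LHS]fin_composeE -(naturality v f) fin_composeE.
congr (vf Y _).
by rewrite ffunE /= /fapp ffunE.
Qed.

(** * Sums of representables and connected colimits *)

Definition from_void (X : finType) : {ffun void -> X} :=
  [ffun x => match x : void with end].

Lemma sum_of_representables_connected (D : functor (op Fin) Fin) :
  is_sum_of_representables D -> sends_connected_colimits_to_limits D.
Proof.
case=> I [d [phi [phi_bij phi_nat]]] J X L q [[j0] J_conn] [q_cocone q_univ].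
(* [I] embeds in [D void], so its equality is decidable and dependent pairs
   over [I] have injective second components without axioms. *)
have I_dec (i i' : I) : {i = i'} + {i <> i'}.
  pose k i := phi void (existT _ i (from_void (d i))).
  case: (k i =P k i') => [kii'|kii']; [left|right].
    by have /(congr1 tag) := bij_inj (phi_bij void) kii'.
  by move=> ii'; apply: kii'; rewrite ii'.
have phi_inj (Y : finType) (i i' : I) g g' :
    phi Y (existT _ i g) = phi Y (existT _ i' g') -> i = i'.
  by move=> /(bij_inj (phi_bij Y)) /(congr1 tag).
have phi_inj2 (Y : finType) (i : I) g g' :
    phi Y (existT _ i g) = phi Y (existT _ i g') -> g = g'.
  by move=> /(bij_inj (phi_bij Y)); apply: inj_pair2_eq_dec.
have phi_surj (Y : finType) z : exists i g, z = phi Y (existT _ i g).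
  by have [h _ hK] := phi_bij Y; exists (tag (h z)), (tagged (h z));
    rewrite -[LHS]hK; case: (h z).
apply: is_limit_elementwise => [i j f|x x_cone].
  by rewrite -[LHS](fmap_comp D) -(q_cocone _ _ f).
pose in_summand j i := exists g, x j = phi (X j) (existT _ i g).
(* Restriction along [fmap X f] preserves summands by [phi_nat]. In the forward direction, [x b]
   lies in some summand, which must be that of its restriction [x a]. *)
have in_summand_hom a b (f : @hom J a b) i : in_summand a i <-> in_summand b i.
  have xE : @fapp _ D (X b) (X a) (fmap X f) (x b) = x a.
    exact: (x_cone b a f).
  split=> [[g xaE]|[g xbE]].
    have [i' [g' xbE]] := phi_surj _ (x b).
    move: xE; rewrite xaE xbE phi_nat => /phi_inj <-.
    by exists g'.
  by exists (fapp (representable (d i)) (fmap X f) g); rewrite -xE xbE phi_nat.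
have [i0 xj0] := phi_surj _ (x j0).
have summand_i0 j : in_summand j i0.
  suff [imp _] : in_summand j0 i0 <-> in_summand j i0 by apply: imp.
  (* Connectedness carries the summand of [x j0] along zigzags to every [j]. *)
  elim: (J_conn j0 j) => [a b [f]|a|a b _ IH|a b c _ IH1 _ IH2].
  - exact: in_summand_hom.
  - by [].
  - exact: iff_sym.
  - exact: iff_trans IH1 IH2.
have x_summand j : exists g, x j == phi (X j) (existT _ i0 g).
  by have [g ->] := summand_i0 j; exists g.
pose g j : {ffun (X j : finType) -> d i0} := xchoose (x_summand j).
have xE j : x j = phi (X j) (existT _ i0 (g j)).
  by apply/eqP; apply: (xchooseP (x_summand j)).
have g_cocone a b (f : @hom J a b) : fin_comp (g b) (fmap X f) = g a.
  have : @fapp _ D (X b) (X a) (fmap X f) (x b) = x a := x_cone b a f.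
  by rewrite !xE phi_nat fapp_representable => /phi_inj2.
have [h [hP h_uniq]] := q_univ (d i0) g g_cocone.
exists (phi L (existT _ i0 h)); split=> [j|y yP].
  rewrite xE -(hP j).
  have := phi_nat L (X j) (q j) i0 h.
  by rewrite fapp_representable.
have [i [h' yE]] := phi_surj L y.
have qyE j : phi (X j) (existT _ i (fin_comp h' (q j))) = x j.
  by rewrite -fapp_representable -phi_nat -yE; apply: yP.
(* Nonemptiness of [J] is used again: the leg at [j0] detects the summand of [y]. *)
have i0E : i0 = i by have := qyE j0; rewrite xE => /phi_inj.
rewrite {}yE; case: _ / i0E in h' qyE *.
rewrite (h_uniq h') // => j.
by have := qyE j; rewrite xE => /phi_inj2.
Qed.

(** * Wide pushouts as connected colimits *)

Section Star.
Variable I : Type.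

(* [None] is the common domain.  Morphisms between legs are equality proofs, as
   [I] need not have decidable equality. *)
Definition star_hom (a b : option I) : Type :=
  match a, b with
  | None, _ => unit
  | Some i, Some j => i = j
  | Some _, None => Empty_set
  end.

Definition star_id (a : option I) : star_hom a a :=
  if a is Some i then erefl i else tt.

Definition star_comp (a b c : option I) :
  star_hom b c -> star_hom a b -> star_hom a c :=
  match a, b, c with
  | None, _, _ => fun _ _ => tt
  | Some i, Some j, Some k => fun g f => etrans f g
  | Some i, None, _ => fun _ f => match f with end
  | Some i, Some j, None => fun g _ => match g with end
  end.

Lemma star_comp1m a b (f : star_hom a b) : star_comp (star_id b) f = f.
Proof. by case: a b f => [i|] [j|] f; case: f. Qed.

Lemma star_compm1 a b (f : star_hom a b) : star_comp f (star_id a) = f.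
Proof. by case: a b f => [i|] [j|] /= f; [case: _ / f | case: f ..]. Qed.

Lemma star_compA a b c e (h : star_hom c e) (g : star_hom b c)
    (f : star_hom a b) :
  star_comp h (star_comp g f) = star_comp (star_comp h g) f.
Proof.
case: a b c e h g f => [i|] [j|] [k|] [l|] //= h g f; try by case: f.
by case: _ / h.
Qed.

Definition star : category :=
  Category star_comp1m star_compm1 star_compA.

Lemma star_connected : connected star.
Proof.
split; first by exists; exact: None.
have from_None (a : star) :
    clos_refl_sym_trans star (fun a b => inhabited (hom a b)) None a.
  by apply: rst_step; exists; exact: tt.
by move=> i j; apply: (rst_trans _ _ _ None); first apply: rst_sym.
Qed.

Variables (C : category) (A : C) (B : I -> C) (f : forall i, hom A (B i)).

Definition star_obj (a : star) : C := if a is Some i then B i else A.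

Definition star_map (a b : star) : hom a b -> hom (star_obj a) (star_obj b) :=
  match a, b return star_hom a b -> hom (star_obj a) (star_obj b) with
  | None, None => fun _ => idm A
  | None, Some i => fun _ => f i
  | Some i, Some j => fun e =>
      match e in _ = j return hom (B i) (B j) with erefl => idm (B i) end
  | Some _, None => fun e => match e with end
  end.

Lemma star_map_id a : star_map (idm a) = idm (star_obj a).
Proof. by case: a. Qed.

Lemma star_map_comp (a b c : star) (h : hom b c) (g : hom a b) :
  star_map (h ∘ g) = star_map h ∘ star_map g.
Proof.
case: a b c h g => [i|] [j|] [k|] //= h g; rewrite ?composem1 //.
- by case: _ / h; rewrite compose1m.
- by case: _ / h; rewrite compose1m.
Qed.

Definition star_diagram : functor star C := Functor star_map_id star_map_comp.

Definition star_cocone (P : C) (c : hom A P) (q : forall i, hom (B i) P)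
    (a : star) : hom (star_diagram a) P :=
  if a is Some i then q i else c.

(** A cocone on the star is a leg at [None] together with legs that restrict to it, which is wide
    pushout data even for empty [I]. *)
Lemma wide_pushout_colimit (P : C) (c : hom A P) (q : forall i, hom (B i) P) :
  is_wide_pushout f c q -> is_colimit (star_cocone c q).
Proof.
case=> qf q_univ; split=> [[i|] [j|] //= e|T t t_cocone].
- by case: _ / e; rewrite composem1.
- exact: composem1.
- have [i|h [[hc hq] h_uniq]] := q_univ T (t None) (fun i => t (Some i)).
    exact: (t_cocone None (Some i) tt).
  exists h; split=> [[i|] //=|h' h'P].
  by apply: h_uniq; split=> [|i]; [apply: (h'P None) | apply: (h'P (Some i))].
Qed.

End Star.

Lemma connected_wide_pushouts (D : functor (op Fin) Fin) :
  sends_connected_colimits_to_limits D ->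
  sends_wide_pushouts_to_wide_pullbacks D.
Proof.
move=> D_conn I A B f P c q q_push.
have [D_cone D_lim] := D_conn _ _ _ _ (star_connected I)
  (wide_pushout_colimit q_push).
split=> [i|T s t ft]; first exact: (D_cone (Some i) None tt).
pose t' a : hom T (D (star_diagram f a)) :=
  match a return hom T (D (star_diagram f a)) with
  | Some i => t i
  | None => s
  end.
have [|h [hP h_uniq]] := D_lim T t'.
  (* Apart from the legs, the star has only identities, so the remaining cone equations concern [D]
     applied to an identity. *)
  have idE Y (r : hom T (D Y)) : fmap D (idm Y) ∘ r = r.
    by rewrite fmap_id compose1m.
  move=> [i|] [j|] //= e; first by case: _ / e; apply: idE.
  exact: idE.
exists h; split.
  by split=> [|i]; [apply: (hP None) | apply: (hP (Some i))].
by move=> h' [h'c h'q]; apply: h_uniq => -[i|]; [apply: h'q | apply: h'c].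
Qed.

(** * Reconstruction of the functor from its values on [void] and [unit] *)

Definition point (X : finType) (x : X) : {ffun unit -> X} := [ffun=> x].

Lemma from_voidE (X : finType) (f : {ffun void -> X}) : f = from_void X.
Proof. by apply/ffunP => -[]. Qed.

Lemma points_wide_pushout (X : Fin) :
  @is_wide_pushout Fin (X : finType) void (fun=> unit) (fun=> from_void unit)
    X (from_void X) (@point X).
Proof.
split=> [i|T s t st]; first exact: from_voidE.
exists ([ffun x => (t x : {ffun unit -> (T : finType)}) tt]).
split=> [|h [_ hP]].
  split=> [|i]; first by rewrite (from_voidE s); apply: from_voidE.
  by apply/ffunP => -[]; rewrite fin_composeE !ffunE.
by apply/ffunP => x; rewrite ffunE -hP fin_composeE ffunE.
Qed.

Section Fibres.
Variable D : functor (op Fin) Fin.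
Hypothesis D_wide : sends_wide_pushouts_to_wide_pullbacks D.

Let D0 : finType := D void.
Let D1 : finType := D unit.
Let base : D1 -> D0 := @fapp _ D unit void (from_void unit).

Definition fibre (s : D0) : finType := {y : D1 | base y == s}.

(** The condition over [void] is stated separately because for empty [X] there are no points to
    determine the base element. *)
Definition glues (X : finType) (p : {s : D0 & {ffun X -> fibre s}})
    (z : (D X : finType)) : bool :=
  (@fapp _ D X void (from_void X) z == tag p) &&
  [forall x, @fapp _ D X unit (point x) z == val (tagged p x)].

(** This is the universal property of the wide pullback [D X], tested on cones with apex [unit]. *)
Lemma glues_exists_unique X p : exists! z, @glues X p z.
Proof.
have [_ D_lim] := D_wide (points_wide_pushout X).
have [|h [[hc hq] h_uniq]] := D_lim (unit : finType)
    ([ffun=> tag p] : {ffun unit -> D0})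
    (fun x => [ffun=> val (tagged p x)] : {ffun unit -> D1}).
  move=> x; apply/ffunP => -[]; rewrite fin_composeE !ffunE.
  exact/eqP/(valP (tagged p x)).
exists ((h : {ffun unit -> (D X : finType)}) tt); split=> [|z].
  apply/andP; split.
    by rewrite /fapp -fin_composeE hc ffunE.
  by apply/forallP => x; rewrite /fapp -fin_composeE hq ffunE.
case/andP=> /eqP zc /forallP zq.
rewrite (h_uniq ([ffun=> z] : {ffun unit -> (D X : finType)})) ?ffunE //.
split=> [|x]; apply/ffunP => -[]; rewrite fin_composeE !ffunE //.
exact/eqP/zq.
Qed.

Lemma glues_exists X p : exists z, @glues X p z.
Proof. by have [z [zP _]] := glues_exists_unique p; exists z. Qed.

Definition glue X p : (D X : finType) := xchoose (@glues_exists X p).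

Lemma glueP X p : glues p (@glue X p).
Proof. exact: (xchooseP (glues_exists p)). Qed.

Lemma glue_eq X p z : glues p z -> @glue X p = z.
Proof.
move=> zP; have [z' [_ z'_uniq]] := glues_exists_unique p.
by rewrite -(z'_uniq _ (glueP p)) (z'_uniq z).
Qed.

(** A glued element remembers its data through its restrictions to [void] and to the points.
    Conversely any [z] is the glueing of its own restrictions, which lie in one fibre since all maps
    out of [void] agree. *)
Lemma glue_bij X : bijective (@glue X).
Proof.
apply: inj_surj_bij => [[s g] [s' g'] eq_glue|z].
  have /andP[/eqP zs /forallP zg] := glueP (existT _ s g).
  have /andP[/eqP zs' /forallP zg'] := glueP (existT _ s' g').
  have ss' : s = s' by rewrite -[LHS]zs eq_glue.
  case: _ / ss' in g' eq_glue zs' zg' *; congr existT.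
  apply/ffunP => x; apply: val_inj.
  by rewrite -(eqP (zg x)) eq_glue (eqP (zg' x)).
have zP x : base (@fapp _ D X unit (point x) z)
            == @fapp _ D X void (from_void X) z.
  rewrite /base -fapp_comp; apply/eqP; congr (@fapp _ D X void _ _).
  exact: from_voidE.
exists (existT _ (@fapp _ D X void (from_void X) z)
  [ffun x => Sub (@fapp _ D X unit (point x) z) (zP x) : fibre _]).
apply/eqP/glue_eq/andP; split=> //=.
by apply/forallP => x; rewrite ffunE SubK.
Qed.

(** Naturality follows from uniqueness of glueing: restricting along [f] a glueing of [g] yields a
    glueing of [g] precomposed with [f]. *)
Lemma fibres_sum : is_sum (fun s => representable (fibre s)) D.
Proof.
exists glue; split=> [|X Y f s g]; first exact: glue_bij.
have /andP[/eqP zs /forallP zg] := glueP (existT _ s g).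
rewrite fapp_representable; symmetry; apply: glue_eq; apply/andP; split=> /=.
  rewrite -fapp_comp -[X in _ == X]zs; apply/eqP; congr (@fapp _ D X void _ _).
  exact: from_voidE.
apply/forallP => y; rewrite -fapp_comp ffunE -(eqP (zg _)).
apply/eqP; congr (@fapp _ D X unit _ _).
by apply/ffunP => -[]; rewrite !ffunE.
Qed.

End Fibres.

(** * Finite sums of representables as Dirichlet polynomials *)

(** Summands are grouped by the cardinality of the representing set: the coefficient [a k] counts
    the indices [i] with [d i] of size [k], and enumeration identifies each such [d i] with
    ['I_k]. *)
Lemma finite_sum_dirichlet (D : functor (op Fin) Fin) (I : finType)
    (d : I -> finType) :
  is_sum (fun i => representable (d i)) D -> is_dirichlet_polynomial D.
Proof.
case=> phi [phi_bij phi_nat].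
pose n := \max_i #|d i|.
pose S (k : 'I_n.+1) := [set i | #|d i| == k].
pose a k := #|S k|; exists n, a.
pose ind (k : 'I_n.+1) (l : 'I_(a k)) : I := enum_val l.
have card_ind k l : #|d (@ind k l)| = k.
  by have := enum_valP l; rewrite inE => /eqP.
pose label (k : 'I_n.+1) l (x : 'I_k) : d (@ind k l) :=
  enum_val (cast_ord (esym (card_ind k l)) x).
pose unlabel k l (y : d (@ind k l)) : 'I_k :=
  cast_ord (card_ind k l) (enum_rank y).
have labelK k l : cancel (@label k l) (@unlabel k l).
  by move=> x; rewrite /label /unlabel enum_valK cast_ordKV.
have unlabelK k l : cancel (@unlabel k l) (@label k l).
  by move=> y; rewrite /label /unlabel cast_ordK enum_rankK.
pose sumX (X : finType) : finType := @sum_obj (op Fin) _ (fun k : 'I_n.+1 =>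
  fin_sum (fun _ : 'I_(a k) => representable 'I_k)) X.
pose place (X : finType) (s : sumX X) : {i & {ffun X -> d i}} :=
  let: existT k (existT l g) := s in
  existT _ (ind k l) [ffun x => label k l ((g : {ffun X -> 'I_k}) x)].
pose w (X : finType) : {ffun sumX X -> (D X : finType)} :=
  [ffun s => phi X (place X s)].
have w_nat (X Y : finType) (f : {ffun Y -> X}) :
    @compose Fin _ _ _ (w Y) (@fmap _ _ (dirichlet_poly a) X Y f) =
    @compose Fin _ _ _ (@fmap _ _ D X Y f) (w X).
  apply/ffunP => -[k [l g]]; rewrite !fin_composeE.
  rewrite [w X _]ffunE [RHS](phi_nat X Y f) fapp_representable.
  rewrite [w Y _]ffunE /= ffunE /fapp /= ffunE /=.
  congr (phi Y (existT _ _ _)); apply/ffunP => y; rewrite !ffunE /=.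
  by rewrite fapp_representable ffunE.
have w_bij (X : finType) : bijective (w X).
  apply: inj_surj_bij => [[k [l g]] [k' [l' g']]|z].
    rewrite !ffunE /= => /(bij_inj (phi_bij X)) eq_kl.
    have eq_ind : ind k l = ind k' l' := congr1 tag eq_kl.
    (* The degree is recovered as the cardinality of the representing set. *)
    have kk' : k = k' by apply: val_inj; rewrite /= -(card_ind k l) eq_ind.
    case: _ / kk' in l' g' eq_kl eq_ind *.
    have ll' : l = l' := enum_val_inj eq_ind.
    case: _ / ll' in g' eq_kl eq_ind *.
    have /ffunP eq_g := eq_from_Tagged eq_kl.
    suff -> : g = g' by []; apply/ffunP => x.
    by apply: (can_inj (labelK k l)); have := eq_g x; rewrite !ffunE.
  have [psi _ psiK] := phi_bij X; rewrite -(psiK z); case: (psi z) => i g.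
  have lt_in : #|d i| < n.+1 by rewrite ltnS; apply: leq_bigmax.
  (* The degree [k] is the size of [d i], and [l] is the rank of [i] among the indices of that
     size. *)
  have [k [l iE]] : exists k l, i = ind k l.
    have iS : i \in S (Ordinal lt_in) by rewrite inE.
    by exists (Ordinal lt_in), (enum_rank_in iS i); rewrite /ind enum_rankK_in.
  case: _ / (esym iE) in g *.
  exists (existT _ k (existT _ l [ffun x => unlabel k l (g x)])).
  rewrite ffunE /=; apply/eqP; congr (phi X (existT _ _ _)).
  by apply/ffunP => x; rewrite !ffunE unlabelK.
pose wt := @NatTrans (op Fin) Fin (dirichlet_poly a) D w w_nat.
have [u [v [uK vK]]] := nat_isomorphic_bij (u := wt) w_bij.
by exists v, u.
Qed.

Theorem theorem1p2 (D : functor (op Fin) Fin) :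
  [<-> is_dirichlet_polynomial D;
       is_sum_of_representables D;
       sends_connected_colimits_to_limits D;
       sends_wide_pushouts_to_wide_pullbacks D].
Proof.
tfae.
- exact: dirichlet_polynomial_sum.
- exact: sum_of_representables_connected.
- exact: connected_wide_pushouts.
(* The cycle closes because the fibres are indexed by [D void], a finite set. *)
- by move=> D_wide; apply: finite_sum_dirichlet (fibres_sum D_wide).
Qed.
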